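(* Let $b$ be a positive integer, $c$ a positive real number, and $$h_n(x)={}_2F_1(1+n,-b+n;c+n;-x).$$ Then the map $x\mapsto h_1(x)/(h_0(x))^2$ is strictly decreasing on $[0,\infty)$, and $$b(c+1)\cdot\left(h_1(x)\right)^2\geq (b-1)c\cdot h_0(x)h_2(x)\quad\text{for all } x\geq 0,$$ where, when $b=1$, the right-hand side of the inequality is understood to be zero.
   Context: ${}_2F_1$ is the ordinary hypergeometric function, satisfying ${}_2F_1(a,b;c;z)=\sum_{X=0}^{\infty}\frac{(a)_X(b)_X}{(c)_X}\frac{z^X}{X!}$ if $b\in\{0,-1,-2,\ldots\}$ or $|z|<1$. Here $(c)_X$ is the Pochhammer symbol: $(c)_0=1$ and $(c)_X=c(c+1)\cdots(c+X-1)$ for positive integers $X$. *)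

(* Defs.v *)
From HB Require Import structures.
From mathcomp Require Import all_boot all_order all_algebra.
From mathcomp Require Import all_classical all_reals all_analysis.

Set Implicit Arguments.
Unset Strict Implicit.
Unset Printing Implicit Defensive.

Import Order.TTheory GRing.Theory Num.Theory.
Import numFieldNormedType.Exports.

Local Open Scope classical_set_scope.
Local Open Scope ring_scope.

Definition pochhammer (R : realType) (c : R) (X : nat) : R :=
  \prod_(i < X) (c + i%:R).

(* The sum of the Gauss series.  This is the value of 2F1(a, b; c; z) when [b]
   is a nonpositive integer (the terms eventually vanish) or [`|z| < 1], with
   [c] not a nonpositive integer.  Elsewhere the series need not converge, and
   the value, being the default one of [limn], need not be that of the analytic
   continuation. *)
Definition hyp2F1 (R : realType) (a b c z : R) : R :=
  limn (series (fun X : nat =>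
    pochhammer a X * pochhammer b X / pochhammer c X * (z ^+ X / X`!%:R))).

(* For [n <= b] the second parameter is a nonpositive integer, so this is then
   the hypergeometric function at every [x]. *)
Definition hyp_h (R : realType) (b : nat) (c : R) (n : nat) (x : R) : R :=
  hyp2F1 (1 + n%:R) (- b%:R + n%:R) (c + n%:R) (- x).

(* Main.v *)
Require Import Defs.
From HB Require Import structures.
From mathcomp Require Import all_boot all_order all_algebra.
From mathcomp Require Import all_classical all_reals all_analysis.
From mathcomp Require Import ring zify.

Set Implicit Arguments.
Unset Strict Implicit.
Unset Printing Implicit Defensive.

Import Order.TTheory GRing.Theory Num.Theory.
Import numFieldNormedType.Exports.

Local Open Scope ring_scope.

(** Let [a k] be the coefficient of [x ^ k] in [h_0], that is, the falling
    factorial of [b] divided by the rising factorial of [c], and let [p] be the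
    polynomial with these coefficients.  Termwise comparison gives
    [p^`N(n) = a n * h_n] for [n <= b] ([nderivn_hyp_poly]), so [h_1] is a
    multiple of [p'], and [h_2] one of [p''] when [b >= 2].  Up to positive constants [h_1 / h_0 ^ 2] is
    [p' / p ^ 2 = - (1 / p)'], and both claims say that [1 / p] is convex on the
    nonnegative half-line: strictly so for the first, in the form
    [p'^2 - p p'' / 2 >= 0] for the second.

    This polynomial has nonnegative coefficients as soon as the coefficients of
    [p] are log-concave ([coef_inv_convexity_ge0]).  Indeed, collecting the
    products [a i * a (s - i)], twice its coefficient of degree [s - 2] is the
    sum over [i <= s] of [(3 i (s - i) - C(s, 2)) * (a i * a (s - i))].  The
    weights [3 i (s - i) - C(s, 2)] add up to zero, which reflects that
    [1 / p] is affine when [p] is a geometric series.  Log-concavity makes the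
    products [a i * a (s - i)] grow as [i] moves towards [s / 2], and the weights
    do the same, so Chebyshev's sum inequality ([chebyshev_sum_ge0]) shows that
    the sum is nonnegative.

    For the hypergeometric coefficients the ratio
    [a (k + 1) / a k = (b - k) / (c + k)] is decreasing in [k], which is
    log-concavity; it is strictly decreasing at [k = 0], so the constant term of
    [p'^2 - p p'' / 2] is positive, whence strict convexity.  The mean value
    theorem then yields strict monotonicity ([deriv_over_sqr_decr]). *)

(** * Chebyshev's sum inequality with centred weights *)

(** Summing the hypothesis over all pairs [(i, j)] gives
    [2 n (\sum w p) - 2 (\sum w) (\sum p)], and the last term vanishes. *)
Lemma chebyshev_sum_ge0 (R : realDomainType) (n : nat) (w p : nat -> R) :
  (forall i j, (i < n)%N -> (j < n)%N -> 0 <= (w i - w j) * (p i - p j)) ->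
  \sum_(i < n) w i = 0 -> 0 <= \sum_(i < n) w i * p i.
Proof.
move=> wp w0; case: n => [|n] in wp w0 *; first by rewrite big_ord0.
have: 0 <= \sum_(i < n.+1) \sum_(j < n.+1) (w i - w j) * (p i - p j).
  by apply: sumr_ge0 => i _; apply: sumr_ge0 => j _; apply: wp.
under eq_bigr => i _.
  have -> : \sum_(j < n.+1) (w i - w j) * (p i - p j)
      = w i * p i *+ n.+1 - w i * (\sum_(j < n.+1) p j)
        + \sum_(j < n.+1) w j * p j.
    transitivity (\sum_(j < n.+1)
        (w i * p i - w i * p j - p i * w j + w j * p j)).
      by apply: eq_bigr => j _; ring.
    rewrite big_split !sumrB /= sumr_const card_ord -!mulr_sumr w0.
    by rewrite mulr0 subr0.
  over.
rewrite big_split sumrB sumrMnl -mulr_suml w0 mul0r subr0 sumr_const card_ord.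
by rewrite /= -mulr2n pmulrn_lge0 // pmulrn_lge0.
Qed.

Lemma sum_mul_compl (s : nat) :
  (\sum_(i < s.+1) i * (s - i) = 'C(s.+1, 3))%N.
Proof.
elim: s => [|s IHs]; first by rewrite big_ord_recl big_ord0.
rewrite big_ord_recr /= subnn muln0 addn0 binS -IHs -bin2_sum.
rewrite big_mkord -big_split /=; apply: eq_bigr => i _.
have le_is : (i <= s)%N by rewrite -ltnS.
by rewrite subSn // mulnS addnC.
Qed.

(** Choosing two elements in a disjoint union: both on one side, or one on each
    side. *)
Lemma bin2D (i j : nat) : ('C(i + j, 2) = 'C(i, 2) + 'C(j, 2) + i * j)%N.
Proof.
elim: i => [|i IHi]; first by rewrite mul0n addn0.
by rewrite addSn !binS !bin1 IHi; lia.
Qed.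

Lemma sum_weight_eq0 (R : comNzRingType) (s : nat) :
  \sum_(i < s.+1) (3%:R * (i * (s - i))%:R - 'C(s, 2)%:R) = 0 :> R.
Proof.
rewrite sumrB -mulr_sumr sumr_const card_ord -natr_sum sum_mul_compl.
by rewrite -natrM -mul_bin_diag natrM mulr_natl subrr.
Qed.

(** * Log-concave sequences *)

Section LogConcave.
Variables (R : realDomainType) (a : nat -> R).

(** Cross-multiplied form of the fact that [a k.+1 / a k] is nonincreasing, which
    remains meaningful at the zeros of [a]: with only the case [j = i + 1] a
    nonnegative sequence could vanish and then become positive again. *)
Definition log_concave_seq :=
  forall i j, (i <= j)%N -> a i * a j.+1 <= a i.+1 * a j.

(** Moving both indices one step inwards, with a constant sum, is one instance of
    log-concavity. *)
Lemma log_concave_seq_nested (s i j : nat) :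
  log_concave_seq -> (j <= i)%N -> (i <= s - i)%N ->
  a j * a (s - j)%N <= a i * a (s - i)%N.
Proof.
move=> alc; elim: i => [|i IHi] ji is2.
  by move: ji; rewrite leqn0 => /eqP->.
move: ji; rewrite leq_eqVlt => /predU1P[-> //|ji].
apply: (le_trans (IHi _ _)); [lia..|].
have -> : (s - i = (s - i.+1).+1)%N by lia.
by apply: alc; lia.
Qed.

(** Both [i * (s - i)] and [a i * a (s - i)] are symmetric under [i |-> s - i] and
    nondecreasing for [i <= s / 2], hence they are similarly ordered. *)
Lemma log_concave_seq_similarly_ordered (s i j : nat) :
  log_concave_seq -> (i <= s)%N -> (j <= s)%N ->
  0 <= ((i * (s - i))%:R - (j * (s - j))%:R)
       * (a i * a (s - i)%N - a j * a (s - j)%N).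
Proof.
move=> alc is_ js.
wlog i2 : i is_ / (i <= s - i)%N.
  move=> H; have [|i2] := leqP i (s - i); first exact: H.
  have := H (s - i)%N; rewrite subKn // [((s - i) * i)%N]mulnC.
  by rewrite [a _ * a i]mulrC; apply; lia.
wlog j2 : j js / (j <= s - j)%N.
  move=> H; have [|j2] := leqP j (s - j); first exact: H.
  have := H (s - j)%N; rewrite subKn // [((s - j) * j)%N]mulnC.
  by rewrite [a _ * a j]mulrC; apply; lia.
wlog ji : i j is_ js i2 j2 / (j <= i)%N.
  move=> H; have [ji|/ltnW ij] := leqP j i; first by apply: H.
  by rewrite -mulrNN !opprB; apply: H.
apply: mulr_ge0; rewrite subr_ge0; last exact: log_concave_seq_nested.
by rewrite ler_nat; nia.
Qed.

End LogConcave.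

(** * Convexity of the reciprocal of a polynomial *)

Section LogConcavePoly.
Variable R : realDomainType.
Implicit Types p : {poly R}.

(** Since [p^`N(2) = p'' / 2], this is [p ^ 3 / 2] times the second derivative of
    [1 / p]. *)
Definition inv_convexity p : {poly R} := p^`N(1) ^+ 2 - p * p^`N(2).

(** The contribution of [a i * a (s - i)] from the two terms is
    [i (s - i) - C(s - i, 2)]; adding its mirror image under [i |-> s - i] gives
    [3 i (s - i) - C(s, 2)] by [bin2D].  The mirror image accounts for the factor
    two. *)
Lemma coef_inv_convexity p (m : nat) :
  let a i := p`_i in
  (inv_convexity p)`_m *+ 2 =
  \sum_(i < m.+3) (3%:R * (i * (m.+2 - i))%:R - 'C(m.+2, 2)%:R)
                   * (a i * a (m.+2 - i)%N).
Proof.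
move=> a; set d := inv_convexity p.
(* Multiplication by ['X^2] turns the coefficients of the derivatives into
   multiples of [a i] without a shift of the index. *)
have X1 i : (p^`N(1) * 'X)`_i = a i *+ i.
  by rewrite coefMX; case: i => //= i; rewrite coef_nderivn add1n bin1.
have X2 i : (p^`N(2) * 'X^2)`_i = a i *+ 'C(i, 2).
  rewrite coefMXn; case: ltnP => [|i2]; first by move=> /bin_small->.
  by rewrite coef_nderivn subnKC.
have -> : d`_m = (d * 'X^2)`_(m.+2) by rewrite coefMXn /= !subSS subn0.
have -> : d * 'X^2 = (p^`N(1) * 'X) ^+ 2 - p * (p^`N(2) * 'X^2).
  by rewrite /d /inv_convexity; ring.
rewrite coefB expr2 !coefM mulrnBl.
under eq_bigr do rewrite !X1.
under [in X in _ - X]eq_bigr do rewrite X2.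
rewrite [in X in _ - X]mulr2n.
rewrite [X in _ - (X + _)](reindex_inj rev_ord_inj) /=.
rewrite -sumrMnl -big_split -sumrB /=; apply: eq_bigr => i _.
have im : (i <= m.+2)%N by rewrite -ltnS.
rewrite subSS subKn // -/(a _).
have -> : 'C(m.+2, 2)%:R =
    'C(i, 2)%:R + 'C(m.+2 - i, 2)%:R + (i * (m.+2 - i))%:R :> R.
  by rewrite -!natrD -bin2D subnKC.
rewrite -/(a _) -[_ *+ i]mulr_natl -[_ *+ (_ - _)]mulr_natl natrM.
rewrite -[_ *+ 'C(i, _)]mulr_natl -[_ *+ 'C(m.+2 - i, _)]mulr_natl.
by ring.
Qed.

Lemma coef_inv_convexity_ge0 p (m : nat) :
  log_concave_seq (fun i => p`_i) -> 0 <= (inv_convexity p)`_m.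
Proof.
move=> plc; rewrite -(@pmulrn_lge0 _ _ 2) // coef_inv_convexity.
apply: (chebyshev_sum_ge0 (n := m.+3)
  (w := fun i => 3%:R * (i * (m.+2 - i))%:R - 'C(m.+2, 2)%:R)
  (p := fun i => p`_i * p`_(m.+2 - i))); last exact: sum_weight_eq0.
move=> i j im jm.
have -> : forall x y z : R, 3%:R * x - z - (3%:R * y - z) = 3%:R * (x - y).
  by move=> x y z; ring.
rewrite -mulrA; apply: mulr_ge0 => //.
exact: (log_concave_seq_similarly_ordered (a := fun i => p`_i)).
Qed.

Lemma horner_gt0 p (x : R) :
  (forall i, 0 <= p`_i) -> 0 < p`_0 -> 0 <= x -> 0 < p.[x].
Proof.
move=> p0 p00 x0.
rewrite (horner_coef_wide x (leqnSn _)) big_ord_recl expr0 mulr1.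
by apply: ltr_wpDr => //; apply: sumr_ge0 => i _; rewrite mulr_ge0 // exprn_ge0.
Qed.

(** The middle hypothesis is positivity of the constant term. *)
Lemma inv_convexity_gt0 p (x : R) :
  log_concave_seq (fun i => p`_i) -> p`_0 * p`_2 < p`_1 ^+ 2 -> 0 <= x ->
  0 < (inv_convexity p).[x].
Proof.
move=> plc p1 x0; apply: horner_gt0 => // [i|].
  exact: coef_inv_convexity_ge0.
rewrite coefB expr2 !coefM !big_ord_recl !big_ord0 !addr0 !coef_nderivn.
by rewrite subr_gt0 -expr2.
Qed.

End LogConcavePoly.

(** The derivative of [p' / p ^ 2] is [- 2 * inv_convexity p / p ^ 3]. *)
Lemma deriv_over_sqr_decr (R : realType) (p : {poly R}) (x y : R) :
  (forall z, 0 <= z -> 0 < p.[z]) ->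
  (forall z, 0 <= z -> 0 < (inv_convexity p).[z]) ->
  0 <= x -> x < y ->
  p^`N(1).[y] / p.[y] ^+ 2 < p^`N(1).[x] / p.[x] ^+ 2.
Proof.
move=> p_gt0 convex x0 xy.
pose g (z : R) := p^`().[z] * ((p ^+ 2).[z])^-1.
pose dg (z : R) :=
  - (2%:R * (inv_convexity p).[z]) / p.[z] ^+ 3.
have gE z : p^`N(1).[z] / p.[z] ^+ 2 = g z by rewrite nderivn1 /g horner_exp.
have dgP (z : R) : 0 <= z -> is_derive z 1 g (dg z).
  move=> /p_gt0 pz.
  have q0 : (p ^+ 2).[z] != 0 by rewrite horner_exp expf_neq0 // gt_eqF.
  have dV := is_deriveV q0 (is_derive_poly (p ^+ 2) z).
  have := is_deriveM (is_derive_poly p^`() z) dV.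
  rewrite (_ : _ + _ = dg z) //= /dg /GRing.scale /= /inv_convexity nderivn1.
  have -> : p^`()^`() = p^`N(2) *+ 2.
    by rewrite -derivn1 -derivSn (nderivn_def 2).
  rewrite deriv_exp !hornerE /= expr1; field.
  by rewrite gt_eqF.
have cg : ({within `[x, y], continuous g})%classic.
  apply: derivable_within_continuous => z; rewrite in_itv /= => /andP[xz _].
  by have [] := dgP z (le_trans x0 xz).
have dg0 z : z \in `]x, y[ -> is_derive z 1 g (dg z).
  by rewrite in_itv /= => /andP[/ltW xz _]; apply: dgP; apply: le_trans xz.
have [z] := MVT xy dg0 cg.
rewrite !gE in_itv /= => /andP[/ltW xz _] gxy.
have z0 := le_trans x0 xz.
rewrite -subr_lt0 gxy pmulr_llt0 ?subr_gt0 // /dg.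
rewrite pmulr_llt0 ?invr_gt0 ?exprn_gt0 ?p_gt0 //.
by rewrite oppr_lt0 mulr_gt0 // convex.
Qed.

(** * The Gauss series as a divided derivative *)

Section Hypergeometric.
Variables (R : realType) (b : nat) (c : R).
Hypothesis c_gt0 : 0 < c.

Lemma pochhammerS (z : R) k : pochhammer z k.+1 = pochhammer z k * (z + k%:R).
Proof. exact: big_ord_recr. Qed.

Lemma pochhammerD (z : R) n k :
  pochhammer z (n + k) = pochhammer z n * pochhammer (z + n%:R) k.
Proof.
elim: k => [|k IHk]; first by rewrite addn0 /pochhammer big_ord0 mulr1.
by rewrite addnS !pochhammerS IHk natrD; ring.
Qed.

Lemma pochhammer_gt0 (z : R) k : 0 < z -> 0 < pochhammer z k.
Proof. by move=> z0; apply: prodr_gt0 => i _; rewrite ltr_wpDr. Qed.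

Lemma pochhammer_ffact (m k : nat) :
  pochhammer (- m%:R : R) k = (-1) ^+ k * (m ^_ k)%:R.
Proof.
elim: k => [|k IHk]; first by rewrite /pochhammer big_ord0 expr0 mulr1.
rewrite pochhammerS IHk ffactnSr exprS.
have [mk|km] := ltnP m k.
  by rewrite ffact_small // mulr0 !mul0n mulr0 mul0r.
by rewrite natrM natrB //; ring.
Qed.

Lemma pochhammer_succ (n k : nat) :
  pochhammer (1 + n%:R : R) k = (k`! * 'C(n + k, n))%:R.
Proof.
have fE j : pochhammer (1 : R) j = (j`!)%:R.
  elim: j => [|j IHj]; first by rewrite /pochhammer big_ord0.
  by rewrite pochhammerS IHj factS natrM mulrC -natr1 addrC.
apply: (mulfI (_ : (n`!)%:R != 0)); first by rewrite pnatr_eq0 -lt0n fact_gt0.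
rewrite -{1}fE -pochhammerD fE -natrM; congr _%:R.
by rewrite -(@bin_fact (n + k) n) ?leq_addr // addKn; lia.
Qed.

(** The terms of [h_0] at [x = 1]. *)
Definition hyp_coef (k : nat) : R := (b ^_ k)%:R / pochhammer c k.

Definition hyp_poly : {poly R} := \poly_(k < b.+1) hyp_coef k.

Lemma coef_hyp_poly k : hyp_poly`_k = hyp_coef k.
Proof.
rewrite coef_poly ltnS; case: leqP => // bk.
by rewrite /hyp_coef ffact_small ?mul0r.
Qed.

Lemma hyp_coefS k :
  hyp_coef k.+1 = hyp_coef k * ((b - k)%:R / (c + k%:R)).
Proof.
by rewrite /hyp_coef ffactnSr pochhammerS natrM invfM; ring.
Qed.

Lemma hyp_coef_ge0 k : 0 <= hyp_coef k.
Proof. by rewrite divr_ge0 // ltW // pochhammer_gt0. Qed.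

Lemma hyp_coef_gt0 k : (k <= b)%N -> 0 < hyp_coef k.
Proof. by move=> kb; rewrite divr_gt0 ?pochhammer_gt0 // ltr0n ffact_gt0. Qed.

Lemma hyp_coef_log_concave : log_concave_seq hyp_coef.
Proof.
move=> i j ij; rewrite !hyp_coefS [leRHS]mulrAC mulrA.
apply: ler_wpM2l; first by rewrite mulr_ge0 ?hyp_coef_ge0.
apply: ler_pM; rewrite ?invr_ge0 ?ler_nat ?leq_sub2l ?addr_ge0 ?(ltW c_gt0) //.
by rewrite lef_pV2 ?posrE ?ltr_wpDr // lerD2l ler_nat.
Qed.

Lemma hyp_coef_log_concave_strict :
  (0 < b)%N -> hyp_coef 0 * hyp_coef 2 < hyp_coef 1 ^+ 2.
Proof.
move=> b0; rewrite (hyp_coefS 1) expr2 mulrCA.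
rewrite ltr_pM2l ?hyp_coef_gt0 // (hyp_coefS 0) ltr_pM2l ?hyp_coef_gt0 // subn0.
rewrite addr0; apply: (@le_lt_trans _ _ ((b - 1)%:R / c)).
  by apply: ler_wpM2l => //; rewrite lef_pV2 ?posrE ?ltr_wpDr // lerDl.
by rewrite ltr_pM2r ?invr_gt0 // ltr_nat; lia.
Qed.

(** Pochhammer symbols and falling factorials split over [n + k], so
    [hyp_coef (n + k)] is [hyp_coef n] times the corresponding coefficient for [b - n] and [c + n]; the binomial
    coefficient of the divided derivative is the rising factorial of [1 + n] over
    [k!].  The two alternating signs, from [- b + n] and from [- x], cancel. *)
Lemma nderivn_hyp_poly n x : (n <= b)%N ->
  hyp_poly^`N(n).[x] = hyp_coef n * hyp_h b c n x.
Proof.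
move=> nb; set t := fun X : nat => pochhammer (1 + n%:R : R) X
  * pochhammer (- b%:R + n%:R) X / pochhammer (c + n%:R) X
  * ((- x) ^+ X / X`!%:R).
(* The two series agree term by term up to the factor [hyp_coef n]; both vanish
   beyond [b]. *)
have tE k : hyp_coef n * t k = hyp_poly^`N(n)`_k * x ^+ k.
  rewrite coef_nderivn coef_hyp_poly /hyp_coef /t pochhammerD.
  have -> : - b%:R + n%:R = - (b - n)%:R :> R by rewrite natrB // opprB addrC.
  rewrite pochhammer_ffact pochhammer_succ.
  have -> : b ^_ (n + k) = (b ^_ n * (b - n) ^_ k)%N.
    elim: k => [|k IHk]; first by rewrite addn0 ffactn0 muln1.
    by rewrite addnS !ffactnSr IHk subnDA mulnA.
  rewrite -[_ *+ 'C(_, _)]mulr_natl !natrM (exprNn x).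
  have s1 : (-1) ^+ k * (-1) ^+ k = 1 :> R.
    by rewrite -exprMn mulrNN mulr1 expr1n.
  have kf : (k`!)%:R != 0 :> R by rewrite pnatr_eq0 -lt0n fact_gt0.
  have p1 : pochhammer c n != 0 by rewrite gt_eqF // pochhammer_gt0.
  have p2 : pochhammer (c + n%:R) k != 0.
    by rewrite gt_eqF // pochhammer_gt0 // ltr_wpDr.
  transitivity ((-1) ^+ k * (-1) ^+ k * ('C(n + k, n)%:R *
     ((b ^_ n)%:R * ((b - n) ^_ k)%:R
       / (pochhammer c n * pochhammer (c + n%:R) k)) * x ^+ k)).
    by field; rewrite kf p1 p2.
  by rewrite s1 mul1r.
have an0 : hyp_coef n != 0 by rewrite gt_eqF // hyp_coef_gt0.
have szN : (size hyp_poly^`N(n) <= b.+1)%N.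
  apply/leq_sizeP => j bj; rewrite coef_nderivn coef_hyp_poly /hyp_coef.
  by rewrite ffact_small ?mul0r ?mul0rn // (leq_trans bj) ?leq_addl.
rewrite /hyp_h /hyp2F1 -/t.
suff -> : limn (series t) = \sum_(k < b.+1) t k.
  rewrite mulr_sumr (horner_coef_wide _ szN).
  by apply: eq_bigr => k _; rewrite tE.
apply: lim_near_cst => //; exists b.+1 => // N /= bN.
rewrite /series /= (big_cat_nat _ bN) //= big_mkord [X in _ + X]big_nat_cond.
rewrite [X in _ + X]big1 ?addr0 // => k /andP[/andP[bk _] _].
apply: (mulfI an0); rewrite mulr0 tE.
by have /leq_sizeP -> := szN; rewrite ?mul0r.
Qed.

End Hypergeometric.

Theorem theorem7 (R : realType) (b : nat) (c : R)
    (hb : (0 < b)%N) (hc : 0 < c) :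
  (forall x y : R, 0 <= x -> x < y ->
     hyp_h b c 1 y / hyp_h b c 0 y ^+ 2 < hyp_h b c 1 x / hyp_h b c 0 x ^+ 2)
  /\
  (forall x : R, 0 <= x ->
     (if b == 1%N then 0
      else (b%:R - 1) * c * (hyp_h b c 0 x * hyp_h b c 2 x))
     <= b%:R * (c + 1) * hyp_h b c 1 x ^+ 2).
Proof.
have a0 : hyp_coef b c 0 = 1.
  by rewrite /hyp_coef /pochhammer big_ord0 divr1.
have a1 : hyp_coef b c 1 = b%:R / c.
  by rewrite hyp_coefS // a0 mul1r subn0 addr0.
have a2 : hyp_coef b c 2 = b%:R / c * ((b%:R - 1) / (c + 1)).
  by rewrite hyp_coefS // a1 natrB.
have h0E x : (hyp_poly b c).[x] = hyp_h b c 0 x.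
  by rewrite -[hyp_poly b c]nderivn0 nderivn_hyp_poly // a0 mul1r.
have h1E x := nderivn_hyp_poly hc x hb; rewrite a1 in h1E.
have coefE : (fun k => (hyp_poly b c)`_k) = hyp_coef b c.
  by apply/funext => k; rewrite coef_hyp_poly.
have p_gt0 x : 0 <= x -> 0 < (hyp_poly b c).[x].
  move=> x0; apply: horner_gt0 => // [i|]; rewrite coef_hyp_poly.
    exact: hyp_coef_ge0.
  by rewrite a0.
have convex x : 0 <= x -> 0 < (inv_convexity (hyp_poly b c)).[x].
  move=> x0; apply: inv_convexity_gt0 => //; rewrite ?coefE ?coef_hyp_poly.
    exact: hyp_coef_log_concave.
  exact: hyp_coef_log_concave_strict.
have b0 : 0 < b%:R :> R by rewrite ltr0n.
split=> [x y x0 xy|x x0].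
  have := deriv_over_sqr_decr p_gt0 convex x0 xy.
  by rewrite !h1E !h0E -!mulrA !ltr_pM2l ?invr_gt0.
case: eqP => [_|b1].
  by rewrite mulr_ge0 ?sqr_ge0 // mulr_ge0 // addr_ge0 ?(ltW hc).
have b2 : (1 < b)%N by lia.
have le := ltW (convex x x0).
rewrite /inv_convexity !hornerE subr_ge0 h0E h1E nderivn_hyp_poly // a2 in le.
(* The factor clears the denominators of the squared coefficient of degree 1
   and of the coefficient of degree 2. *)
have k0 : 0 < c ^+ 2 * (c + 1) / b%:R.
  by rewrite divr_gt0 // mulr_gt0 ?exprn_gt0 // addr_gt0.
have := ler_wpM2l (ltW k0) le.
rewrite [X in X <= _ -> _](_ : _ =
  (b%:R - 1) * c * (hyp_h b c 0 x * hyp_h b c 2 x)).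
  rewrite [X in _ <= X -> _](_ : _ = b%:R * (c + 1) * hyp_h b c 1 x ^+ 2) //.
  by field; rewrite !gt_eqF.
by field; rewrite !gt_eqF // addr_gt0.
Qed.
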